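(* With $\hat r\in\{\hat q_1,\hat p_1,\dots,\hat q_m,\hat p_m\}$ and $\hat O_0,\dots,\hat O_t$ being $m$-mode displaced orthogonal unitary gates, the evolution of $\hat r$ over $\hat O_te^{i\gamma_t\hat q_1^3}\hat O_{t-1}\cdots\hat O_1e^{i\gamma_1\hat q_1^3}\hat O_0$ can be seen as the weighted sum of its evolution over $t$ unitaries, each consisting of the displaced orthogonal unitary gates and a single (modified) cubic phase gate. That is, $$\hat O_0^\dagger e^{-i\gamma_1\hat q_1^3}\hat O_1^\dagger\cdots\hat O_{t-1}^\dagger e^{-i\gamma_t\hat q_1^3}\hat O_t^\dagger\;\hat r\;\hat O_te^{i\gamma_t\hat q_1^3}\hat O_{t-1}\cdots\hat O_1e^{i\gamma_1\hat q_1^3}\hat O_0=\sum_{k=1}^t\frac{\gamma_k}{\gamma}\left(\hat O_{k-1\dots0}^\dagger\, e^{-i\gamma\hat q_1^3}\,\hat O_{t\dots k}^\dagger\;\hat r\;\hat O_{t\dots k}\, e^{i\gamma\hat q_1^3}\,\hat O_{k-1\dots0}\right),$$ where $\hat O_{j\dots k}:=\hat O_j\hat O_{j-1}\cdots\hat O_k$ for $0\le k\le j\le t$, and $\gamma:=\sum_{k=1}^t\gamma_k$.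
   Context: Setting: an $m$-mode continuous-variable (bosonic) quantum system, $m\ge1$, with position and momentum quadrature operators $\hat q_1,\dots,\hat q_m,\hat p_1,\dots,\hat p_m$ satisfying $[\hat q_j,\hat p_k]=2i\,\delta_{jk}\mathbb I$, all other commutators being zero (convention $\hbar=2$). The evolution of $\hat r$ over a unitary $\hat U$ means $\hat U^\dagger\hat r\hat U$. The symbol $i$ in exponents is the imaginary unit. A Gaussian unitary $\hat G$ (a product of unitaries generated by Hamiltonians quadratic in the quadratures) acts on the vector $\boldsymbol\Gamma=[\hat q_1,\dots,\hat q_m,\hat p_1,\dots,\hat p_m]$ by $\hat G^\dagger\boldsymbol\Gamma\hat G=S\boldsymbol\Gamma+\boldsymbol d$, with $S$ a $2m\times 2m$ symplectic matrix and $\boldsymbol d\in\mathbb R^{2m}$ a displacement vector. Passive linear unitaries are Gaussian unitaries preserving the total particle number. An orthogonal gate is a passive linear unitary whose symplectic matrix in the ordering $\boldsymbol\Gamma$ is block-diagonal with two $m\times m$ orthogonal blocks; in particular it maps position quadratures to position quadratures and momentum quadratures to momentum quadratures. A displaced orthogonal gate is an orthogonal gate up to a multimode displacement. The cubic phase gate $e^{i\gamma\hat q_1^3}$ on the first mode acts by $e^{-i\gamma\hat q_1^3}\hat p_1e^{i\gamma\hat q_1^3}=\hat p_1+3\gamma\hat q_1^2$ and leaves all other quadratures unchanged. *)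

(* Defs.v *)
From HB Require Import structures.
From mathcomp Require Import all_boot all_order all_algebra complex ring.
From mathcomp Require Import all_classical all_reals all_analysis.

Set Implicit Arguments.
Unset Strict Implicit.
Unset Printing Implicit Defensive.

Import Order.TTheory GRing.Theory Num.Theory numFieldNormedType.Exports.
Local Open Scope ring_scope.
Local Open Scope complex_scope.
Local Open Scope classical_set_scope.

(** An m-mode system (m = n.+1 >= 1, so that there is a first mode) is taken in
    the Schroedinger representation on L^2(R^m).  The quadratures are unbounded,
    so every operator identity below is an identity of operators on the common
    invariant core of Schwartz functions. *)

Section ComplexCalculus.
Variables (R : realType) (m : nat).
Implicit Types (f g : 'rV[R]_m -> R[i]) (x v : 'rV[R]_m).

Definition is_cderive x v f (l : R[i]) :=
  is_derive x v (fun y => complex.Re (f y)) (complex.Re l) /\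
  is_derive x v (fun y => complex.Im (f y)) (complex.Im l).

Definition cderivable f x v :=
  derivable (fun y => complex.Re (f y)) x v /\
  derivable (fun y => complex.Im (f y)) x v.

Definition partial (j : 'I_m) f : 'rV[R]_m -> R[i] := fun x =>
  'D_(delta_mx 0 j) (fun y => complex.Re (f y)) x +i*
  'D_(delta_mx 0 j) (fun y => complex.Im (f y)) x.

Definition iter_partial (s : seq 'I_m) f := foldr partial f s.

(* Partial derivatives of all orders exist and are rapidly decreasing; being
   locally bounded, they are automatically continuous. *)
Definition schwartz_fun f :=
  (forall (s : seq 'I_m) (j : 'I_m) x,
     cderivable (iter_partial s f) x (delta_mx 0 j)) /\
  (forall (s : seq 'I_m) (a : 'I_m -> nat), exists M : R, forall x,
     Normc.normc ((\prod_k x 0 k ^+ a k)%:C * iter_partial s f x) <= M).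

End ComplexCalculus.

Section SchwartzClosure.
Variables (R : realType) (m : nat).
Implicit Types (f g : 'rV[R]_m -> R[i]) (x v : 'rV[R]_m).

Lemma is_cderiveP f x v l : is_cderive x v f l -> cderivable f x v.
Proof. by move=> [[? _] [? _]]. Qed.

Lemma cderivableP f x (j : 'I_m) : cderivable f x (delta_mx 0 j) ->
  is_cderive x (delta_mx 0 j) f (partial j f x).
Proof. by move=> [? ?]; split; apply/derivableP. Qed.

Lemma partialE f x (j : 'I_m) l :
  is_cderive x (delta_mx 0 j) f l -> partial j f x = l.
Proof. by case: l => a b [/= h1 h2]; rewrite /partial !derive_val. Qed.

Lemma is_cderiveD f g x v k l :
  is_cderive x v f k -> is_cderive x v g l -> is_cderive x v (f \+ g) (k + l).
Proof.
move=> [f1 f2] [g1 g2]; split.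
- have -> : (fun y => complex.Re ((f \+ g) y)) =
    (fun y => complex.Re (f y)) + (fun y => complex.Re (g y)).
    by apply/funext => y /=; rewrite fctE; case: (f y) (g y) => ? ? [].
  by apply: is_derive_eq; case: k l {f1 f2 g1 g2} => ? ? [].
- have -> : (fun y => complex.Im ((f \+ g) y)) =
    (fun y => complex.Im (f y)) + (fun y => complex.Im (g y)).
    by apply/funext => y /=; rewrite fctE; case: (f y) (g y) => ? ? [].
  by apply: is_derive_eq; case: k l {f1 f2 g1 g2} => ? ? [].
Qed.

Lemma is_cderiveM f g x v k l :
  is_cderive x v f k -> is_cderive x v g l ->
  is_cderive x v (fun y => f y * g y) (k * g x + f x * l).
Proof.
move=> [f1 f2] [g1 g2]; split.
- have -> : (fun y => complex.Re (f y * g y)) =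
    (fun y => complex.Re (f y)) * (fun y => complex.Re (g y)) -
    (fun y => complex.Im (f y)) * (fun y => complex.Im (g y)).
    by apply/funext => y /=; rewrite !fctE; case: (f y) (g y) => ? ? [].
  apply: is_derive_eq; rewrite /GRing.scale /=.
  case: k l (f x) (g x) {f1 f2 g1 g2} => k1 k2 [l1 l2] [a b] [c d] /=.
  by rewrite (mulrC k1) (mulrC k2) opprD addrACA addrC.
- have -> : (fun y => complex.Im (f y * g y)) =
    (fun y => complex.Re (f y)) * (fun y => complex.Im (g y)) +
    (fun y => complex.Im (f y)) * (fun y => complex.Re (g y)).
    by apply/funext => y /=; rewrite !fctE; case: (f y) (g y) => ? ? [].
  apply: is_derive_eq; rewrite /GRing.scale /=.
  case: k l (f x) (g x) {f1 f2 g1 g2} => k1 k2 [l1 l2] [a b] [c d] /=.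
  by rewrite (mulrC k1) (mulrC k2) addrACA addrC.
Qed.

Lemma is_cderive_cst (c : R[i]) x v : is_cderive x v (fun=> c) 0.
Proof. by split; apply: is_derive_cst. Qed.

Lemma is_derive_line (g : 'rV[R]_m -> R) x v (b : R) :
  is_derive x v g b <-> is_derive (0 : R) 1 (fun h : R => g (h *: v + x)) b.
Proof.
suff E : (fun h : R => h^-1 *: ((g \o shift x) (h *: v) - g x)) =
  (fun h : R => h^-1 *: (((fun h : R => g (h *: v + x)) \o shift 0) (h *: 1)
     - g (0 *: v + x))).
  by split=> -[+ <-]; rewrite /derivable /derive -/(derive g x v) => d;
    split; rewrite /derivable /derive ?E // -?E.
by apply/funext => h /=; rewrite scale0r add0r addr0 /GRing.scale /= mulr1.
Qed.

Lemma is_derive_comp1 (F : R -> R) (g : 'rV[R]_m -> R) x v (a b : R) :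
  is_derive (g x) 1 F a -> is_derive x v g b -> is_derive x v (F \o g) (a * b).
Proof.
move=> hF /is_derive_line hg; apply/is_derive_line.
have := @is_derive1_comp R F (fun h : R => g (h *: v + x)) 0 a b.
by rewrite scale0r add0r; apply.
Qed.

Lemma is_derive_coord (j k : 'I_m) x :
  is_derive x (delta_mx 0 j) (fun y : 'rV[R]_m => y 0 k) (k == j)%:R.
Proof.
apply/is_derive_line.
have -> : (fun h : R => (h *: delta_mx 0 j + x) 0 k) =
  (k == j)%:R *: (id : R -> R) + cst (x 0 k).
  apply/funext => h; rewrite !mxE !fctE eqxx /=.
  by rewrite /GRing.scale /= mulrC.
by apply: is_derive_eq; rewrite addr0 /GRing.scale /= mulr1.
Qed.

Lemma is_cderive_real (g : 'rV[R]_m -> R) x v (b : R) :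
  is_derive x v g b -> is_cderive x v (fun y => (g y)%:C) b%:C.
Proof. by move=> h; split=> //=; apply: is_derive_cst. Qed.

(* Coinduction: a class of bounded, partially differentiable functions that is
   stable under multiplication by coordinates (built into the boundedness
   clause) and under partial derivatives consists of Schwartz functions. *)
Lemma schwartz_coind (P : ('rV[R]_m -> R[i]) -> Prop) :
  (forall f, P f -> forall j x, cderivable f x (delta_mx 0 j)) ->
  (forall f, P f -> forall j, P (partial j f)) ->
  (forall f, P f -> forall a : 'I_m -> nat, exists M : R, forall x,
     Normc.normc ((\prod_k x 0 k ^+ a k)%:C * f x) <= M) ->
  forall f, P f -> schwartz_fun f.
Proof.
move=> Pd Pp Pb f Pf.
have Ps s : P (iter_partial s f) by elim: s => //= j s Ps; exact: Pp.
by split=> [s j x|s a]; [apply: Pd|apply: Pb].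
Qed.

Lemma schwartz_derivable f : schwartz_fun f ->
  forall j x, cderivable f x (delta_mx 0 j).
Proof. by move=> [h _] j x; apply: (h [::]). Qed.

Lemma schwartz_bounded f : schwartz_fun f ->
  forall a : 'I_m -> nat, exists M : R, forall x,
     Normc.normc ((\prod_k x 0 k ^+ a k)%:C * f x) <= M.
Proof. by move=> [_ h] a; apply: (h [::]). Qed.

Lemma schwartz_partial j f : schwartz_fun f -> schwartz_fun (partial j f).
Proof.
move=> [hd hb].
have E s : iter_partial s (partial j f) = iter_partial (rcons s j) f.
  by rewrite /iter_partial foldr_rcons.
by split=> [s k x|s a]; rewrite E; [apply: hd|apply: hb].
Qed.

Lemma partialD j f g :
  (forall x, cderivable f x (delta_mx 0 j)) ->
  (forall x, cderivable g x (delta_mx 0 j)) ->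
  partial j (f \+ g) = partial j f \+ partial j g.
Proof.
move=> hf hg; apply/funext => x; apply: partialE.
by apply: is_cderiveD; apply: cderivableP.
Qed.

Lemma schwartzD f g :
  schwartz_fun f -> schwartz_fun g -> schwartz_fun (f \+ g).
Proof.
move=> sf sg.
pose P (h : 'rV[R]_m -> R[i]) := exists f1 f2,
  [/\ schwartz_fun f1, schwartz_fun f2 & h = f1 \+ f2].
apply: (@schwartz_coind P); last by exists f, g.
- move=> _ [f1 [f2 [s1 s2 ->]]] j x; apply: is_cderiveP.
  by apply: is_cderiveD; apply: cderivableP; apply: schwartz_derivable.
- move=> _ [f1 [f2 [s1 s2 ->]]] j; exists (partial j f1), (partial j f2).
  split; [exact: schwartz_partial|exact: schwartz_partial|].
  by apply: partialD => x; apply: schwartz_derivable.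
- move=> _ [f1 [f2 [s1 s2 ->]]] a.
  have [M1 h1] := schwartz_bounded s1 a; have [M2 h2] := schwartz_bounded s2 a.
  exists (M1 + M2) => x; rewrite mulrDr.
  exact: le_trans (le_normcD _ _) (lerD (h1 x) (h2 x)).
Qed.

Lemma schwartzZ (c : R[i]) f :
  schwartz_fun f -> schwartz_fun (fun x => c * f x).
Proof.
move=> sf.
pose P (h : 'rV[R]_m -> R[i]) := exists2 f1,
  schwartz_fun f1 & h = (fun x => c * f1 x).
have D f1 j x : schwartz_fun f1 ->
    is_cderive x (delta_mx 0 j) (fun x => c * f1 x) (c * partial j f1 x).
  move=> s1; have := is_cderiveM (is_cderive_cst c x (delta_mx 0 j))
    (cderivableP (schwartz_derivable s1 j x)).
  by rewrite mul0r add0r.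
apply: (@schwartz_coind P); last by exists f.
- by move=> _ [f1 s1 ->] j x; apply: is_cderiveP; apply: D.
- move=> _ [f1 s1 ->] j; exists (partial j f1); first exact: schwartz_partial.
  by apply/funext => x; apply: partialE; apply: D.
- move=> _ [f1 s1 ->] a; have [M h] := schwartz_bounded s1 a.
  exists (Normc.normc c * M) => x; rewrite mulrCA Normc.normcM.
  by rewrite ler_wpM2l //; case: (c) => u v; apply: sqrtr_ge0.
Qed.

Lemma schwartz0 : schwartz_fun (fun _ : 'rV[R]_m => 0 : R[i]).
Proof.
apply: (@schwartz_coind (fun h => h = (fun=> 0))) => //.
- by move=> _ -> j x; apply: is_cderiveP; apply: is_cderive_cst.
- by move=> _ -> j; apply/funext => x; apply: partialE; apply: is_cderive_cst.
- by move=> _ -> a; exists 0 => x; rewrite mulr0 Normc.normc0.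
Qed.

Lemma schwartz_coord k f :
  schwartz_fun f -> schwartz_fun (fun x => (x 0 k)%:C * f x).
Proof.
move=> sf.
pose X f1 : 'rV[R]_m -> R[i] := fun x => (x 0 k)%:C * f1 x.
pose P (h : 'rV[R]_m -> R[i]) := exists f1 f2,
  [/\ schwartz_fun f1, schwartz_fun f2 & h = X f1 \+ f2].
have D f1 j x : schwartz_fun f1 -> is_cderive x (delta_mx 0 j) (X f1)
    ((k == j)%:R * f1 x + X (partial j f1) x).
  move=> s1; have := is_cderiveM (is_cderive_real (is_derive_coord j k x))
    (cderivableP (schwartz_derivable s1 j x)).
  by rewrite rmorph_nat.
apply: (@schwartz_coind P); last first.
  exists f, (fun=> 0); split=> //; first exact: schwartz0.
  by apply/funext => x /=; rewrite addr0.
- move=> _ [f1 [f2 [s1 s2 ->]]] a.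
  have [M1 h1] := schwartz_bounded s1 (fun i => (a i + (i == k))%N).
  have [M2 h2] := schwartz_bounded s2 a.
  exists (M1 + M2) => x; rewrite mulrDr.
  apply: le_trans (le_normcD _ _) (lerD _ (h2 x)).
  apply: le_trans (h1 x); rewrite /X mulrA -rmorphM /=.
  suff -> : \prod_i x 0 i ^+ (a i + (i == k)) = \prod_i x 0 i ^+ a i * x 0 k.
    by [].
  rewrite (eq_bigr (fun i => x 0 i ^+ a i * x 0 i ^+ (i == k))); last first.
    by move=> i _; rewrite exprD.
  rewrite big_split /=; congr (_ * _).
  rewrite (bigD1 k) //= eqxx expr1 big1 ?mulr1 // => i /negbTE ->.
  by rewrite expr0.
- move=> _ [f1 [f2 [s1 s2 ->]]] j.
  exists (partial j f1), ((fun x => (k == j)%:R * f1 x) \+ partial j f2); split.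
  + exact: schwartz_partial.
  + by apply: schwartzD; [exact: schwartzZ|exact: schwartz_partial].
  + apply/funext => x; apply: partialE => /=.
    rewrite addrA [X (partial j f1) x + _]addrC.
    apply: is_cderiveD; first exact: D.
    exact/cderivableP/schwartz_derivable.
- move=> _ [f1 [f2 [s1 s2 ->]]] j x; apply: is_cderiveP.
  apply: is_cderiveD; first exact: D.
  exact/cderivableP/schwartz_derivable.
Qed.

End SchwartzClosure.

Section Phase.
Variables (R : realType) (n : nat).

Definition expi (t : R) : R[i] := cos t +i* sin t.

Lemma normc_expi t : Normc.normc (expi t) = 1.
Proof. by rewrite /= cos2Dsin2 sqrtr1. Qed.

Lemma expiN t : expi (- t) = (expi t)^*.
Proof. by rewrite /expi /= cosN sinN. Qed.

Lemma expiD s t : expi (s + t) = expi s * expi t.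
Proof. by rewrite /expi cosD sinD; simpc; rewrite [sin s * _ + _]addrC. Qed.

Lemma expi0 : expi 0 = 1.
Proof. by rewrite /expi cos0 sin0. Qed.

Definition cubic_phase (c : R) (x : 'rV[R]_n.+1) : R[i] :=
  expi (c * x 0 ord0 ^+ 3).

Lemma is_cderive_cubic c (x : 'rV[R]_n.+1) j :
  is_cderive x (delta_mx 0 j) (cubic_phase c)
    ('i * (3 * c * (ord0 == j)%:R)%:C * (x 0 ord0)%:C * (x 0 ord0)%:C
       * cubic_phase c x).
Proof.
have hg : is_derive x (delta_mx 0 j) (fun y : 'rV[R]_n.+1 => c * y 0 ord0 ^+ 3)
    (3 * c * (ord0 == j)%:R * x 0 ord0 ^+ 2).
  have hx := is_derive_coord j ord0 x.
  have -> : (fun y : 'rV[R]_n.+1 => c * y 0 ord0 ^+ 3) =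
    c *: (fun y : 'rV[R]_n.+1 => y 0 ord0) ^+ 3.
    by apply/funext => y; rewrite !fctE.
  apply: is_derive_eq; rewrite /GRing.scale /=.
  by ring.
have h1 := is_derive_comp1 (is_derive_cos (c * x 0 ord0 ^+ 3)) hg.
have h2 := is_derive_comp1 (is_derive_sin (c * x 0 ord0 ^+ 3)) hg.
split.
- apply: (is_derive_eq h1).
  rewrite /cubic_phase /expi; simpc; rewrite /=.
  by ring.
- apply: (is_derive_eq h2).
  rewrite /cubic_phase /expi; simpc; rewrite /=.
  by ring.
Qed.

Lemma schwartz_cubic c f : schwartz_fun f ->
  schwartz_fun (fun x : 'rV[R]_n.+1 => cubic_phase c x * f x).
Proof.
move=> sf; pose E f1 (x : 'rV[R]_n.+1) : R[i] := cubic_phase c x * f1 x.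
pose W j f1 := (fun x : 'rV[R]_n.+1 =>
  ('i * (3 * c * (ord0 == j)%:R)%:C) *
     ((x 0 ord0)%:C * ((x 0 ord0)%:C * f1 x))) \+ partial j f1.
have D f1 j x : schwartz_fun f1 ->
    is_cderive x (delta_mx 0 j) (E f1) (E (W j f1) x).
  move=> s1; have := is_cderiveM (is_cderive_cubic c x j)
    (cderivableP (schwartz_derivable s1 j x)).
  rewrite /E /W /= [X in _ -> is_cderive _ _ _ X]mulrDr.
  set l1 := (X in is_cderive _ _ _ (X + _) -> _).
  set l2 := (X in _ -> is_cderive _ _ _ (X + _)).
  suff -> : l1 = l2 by [].
  by rewrite /l1 /l2 [RHS]mulrC !mulrA [RHS]mulrAC.
pose P h := exists2 f1, schwartz_fun f1 & h = E f1.
apply: (@schwartz_coind _ _ P); last by exists f.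
- by move=> _ [f1 s1 ->] j x; apply: is_cderiveP; apply: D.
- move=> _ [f1 s1 ->] j; exists (W j f1).
    apply: schwartzD; last exact: schwartz_partial.
    by apply: schwartzZ; do 2 apply: schwartz_coord.
  by apply/funext => x; apply: partialE; apply: D.
- move=> _ [f1 s1 ->] a; have [M h] := schwartz_bounded s1 a.
  by exists M => x; rewrite mulrCA Normc.normcM normc_expi mul1r.
Qed.

End Phase.

Section SchwartzSpace.
Variables (R : realType) (n : nat).

Definition schwartz_pred : {pred 'rV[R]_n.+1 -> R[i]} :=
  fun f => `[< schwartz_fun f >].

Record schwartz := Schwartz {
  schwartz_val :> 'rV[R]_n.+1 -> R[i];
  _ : schwartz_val \in schwartz_pred }.

HB.instance Definition _ := [isSub of schwartz for schwartz_val].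
HB.instance Definition _ := [Choice of schwartz by <:].

Lemma schwartz_submod_closed : submod_closed schwartz_pred.
Proof.
split; first by apply/asboolP; apply: schwartz0.
move=> c f g /asboolP sf /asboolP sg; apply/asboolP.
by apply: schwartzD => //; apply: schwartzZ.
Qed.

HB.instance Definition _ := GRing.isSubmodClosed.Build _ _ schwartz_pred
  schwartz_submod_closed.
HB.instance Definition _ := [SubChoice_isSubLmodule of schwartz by <:].

Lemma schwartzP (f : schwartz) : schwartz_fun f.
Proof. by apply/asboolP; case: f. Qed.

Definition mk_schwartz f (sf : schwartz_fun f) : schwartz :=
  Schwartz (introT (asboolP _) sf).

End SchwartzSpace.

Section InnerProduct.
Variable R : realType.

(* Iterated Lebesgue integral over R^m, coordinate by coordinate; by Fubini this
   is the integral over R^m for the (integrable) functions it is applied to. *)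
Fixpoint rintegral (m : nat) : ('rV[R]_m -> R) -> R :=
  match m with
  | 0 => fun f => f 0
  | m'.+1 => fun f => Rintegral lebesgue_measure [set: R]
      (fun x : R => rintegral (fun y : 'rV[R]_m' =>
         f (row_mx (x%:M : 'rV[R]_1) y : 'rV[R]_m'.+1)))
  end.

Definition cintegral (m : nat) (f : 'rV[R]_m -> R[i]) : R[i] :=
  rintegral (fun x => complex.Re (f x)) +i*
  rintegral (fun x => complex.Im (f x)).

Definition inner (n : nat) (f g : schwartz R n) : R[i] :=
  cintegral (fun x => (f x)^* * g x).

Definition sqnorm (n : nat) (f : schwartz R n) : R :=
  complex.Re (inner f f).

End InnerProduct.

Section Operators.
Variables (R : realType) (n : nat).
Local Notation S := (schwartz R n).

Definition operator := S -> S.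

(* Unitaries of L^2(R^m) that restrict to bijections of the Schwartz space; the
   adjoint is carried along with the operator. *)
Record unitary := Unitary {
  uop :> S -> S;
  udag : S -> S;
  uop_linear : linear uop;
  udag_adjoint : forall f g, inner (uop f) g = inner f (udag g);
  uopK : cancel uop udag;
  udagK : cancel udag uop }.

Lemma uid_subproof : linear (idfun : operator).
Proof. by []. Qed.

Definition uid : unitary :=
  @Unitary idfun idfun uid_subproof (fun _ _ => erefl)
    (fun _ => erefl) (fun _ => erefl).

Lemma ucomp_linear (U V : unitary) : linear (fun f => U (V f)).
Proof. by move=> c f g; rewrite (uop_linear V) (uop_linear U). Qed.

Lemma ucomp_adjoint (U V : unitary) f g :
  inner (U (V f)) g = inner f (udag V (udag U g)).
Proof. by rewrite !udag_adjoint. Qed.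

Lemma ucompK (U V : unitary) :
  cancel (fun f => U (V f)) (fun f => udag V (udag U f)).
Proof. by move=> f; rewrite !uopK. Qed.

Lemma ucompKd (U V : unitary) :
  cancel (fun f => udag V (udag U f)) (fun f => U (V f)).
Proof. by move=> f; rewrite !udagK. Qed.

Definition ucomp (U V : unitary) : unitary :=
  Unitary (@ucomp_linear U V) (@ucomp_adjoint U V) (@ucompK U V)
    (@ucompKd U V).

Definition evolve (U : unitary) (r : operator) : operator :=
  fun f => udag U (r (U f)).

Definition qop (j : 'I_n.+1) : operator := fun f =>
  mk_schwartz (schwartz_coord j (schwartzP f)).

(* p_j = - 2 i d/dx_j, so that [q_j, p_k] = 2 i delta_jk (hbar = 2). *)
Definition pop (j : 'I_n.+1) : operator := fun f =>
  - (2 * 'i : R[i]) *: mk_schwartz (schwartz_partial j (schwartzP f)).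

Definition Gamma (i : 'I_(n.+1 + n.+1)) : operator :=
  match fintype.split i with inl j => qop j | inr j => pop j end.

Lemma ccr j k f :
  qop j (pop k f) - pop k (qop j f) = (2 * 'i * (j == k)%:R : R[i]) *: f.
Proof.
apply: val_inj; apply/funext => x; rewrite /= !fctE /=.
have := is_cderiveM (is_cderive_real (is_derive_coord k j x))
  (cderivableP (schwartz_derivable (schwartzP f) k x)).
move/partialE; rewrite /GRing.scale /= => ->.
rewrite rmorph_nat eq_sym; move: (partial k f x) (f x) => u v.
by ring.
Qed.

Lemma cubic_linear (c : R) : linear (fun f : S =>
  mk_schwartz (schwartz_cubic c (schwartzP f))).
Proof.
move=> a f g; apply: val_inj; apply/funext => x; rewrite /= !fctE /=.
by rewrite mulrDr [X in X + _]mulrCA.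
Qed.

Lemma cubic_adjoint (c : R) (f g : S) :
  inner (mk_schwartz (schwartz_cubic c (schwartzP f))) g =
  inner f (mk_schwartz (schwartz_cubic (- c) (schwartzP g))).
Proof.
rewrite /inner; apply: (congr1 (@cintegral R n.+1)); apply/funext => x /=.
by rewrite /cubic_phase rmorphM /= mulNr expiN; ring.
Qed.

Lemma cubicK (c d : R) : c + d = 0 ->
  cancel (fun f : S => mk_schwartz (schwartz_cubic c (schwartzP f)))
    (fun f : S => mk_schwartz (schwartz_cubic d (schwartzP f))).
Proof.
move=> cd0 f; apply: val_inj; apply/funext => x /=.
by rewrite mulrA /cubic_phase -expiD -mulrDl addrC cd0 mul0r expi0 mul1r.
Qed.

(* exp (i c q_1^3) acts, by functional calculus, as multiplication by
   exp (i c x_1^3).  With [q_1, p_1] = 2 i it sends p_1 to p_1 + 6 c q_1^2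
   (lemma cubic_evolve_p); the normalization in which p_1 goes to
   p_1 + 3 c q_1^2 is obtained by replacing c with c / 2. *)
Definition cubic (c : R) : unitary :=
  Unitary (@cubic_linear c) (@cubic_adjoint c) (cubicK (subrr c))
    (cubicK (addNr c)).

Lemma cubic_evolve_p c f :
  evolve (cubic c) (pop ord0) f =
  pop ord0 f + (6 * c)%:C *: qop ord0 (qop ord0 f).
Proof.
apply: val_inj; apply/funext => x; rewrite /= !fctE /=.
have := is_cderiveM (is_cderive_cubic c x ord0)
  (cderivableP (schwartz_derivable (schwartzP f) ord0 x)).
move/partialE; rewrite /GRing.scale /= => ->; rewrite mulr1.
have := expiD (- (c * x 0 ord0 ^+ 3)) (c * x 0 ord0 ^+ 3).
rewrite addNr expi0 -mulNr => /esym.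
rewrite -/(cubic_phase (- c) x) -/(cubic_phase c x).
move: (cubic_phase (- c) x) (cubic_phase c x) => e' e ee'.
have i2 : 'i * 'i = -1 :> R[i] by rewrite -expr2 sqr_i.
rewrite !rmorphM /= !rmorph_nat.
move: (partial ord0 f x) (f x) (x 0 ord0)%:C (c%:C) => u v y d.
transitivity (e' * e * (- (2 * 'i) * u - ('i * 'i) * (6 * d * y * y * v))).
  by ring.
by rewrite ee' i2; ring.
Qed.

End Operators.

Arguments uid {R n}.
Arguments qop {R n}.
Arguments pop {R n}.
Arguments Gamma {R n}.
Arguments cubic {R} n c.

Section Gaussian.
Variables (R : realType) (n : nat).
Local Notation S := (schwartz R n).
Local Notation unitary := (unitary R n).
Implicit Types (U V : unitary).

Definition quadratic_hamiltonian (M : 'M[R]_(n.+1 + n.+1))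
    (v : 'cV[R]_(n.+1 + n.+1)) (c : R) : operator R n := fun f =>
  \sum_i \sum_j (M i j)%:C *: Gamma i (Gamma j f)
  + \sum_i (v i 0)%:C *: Gamma i f + c%:C *: f.

(* U = exp (- i H): U is the time-1 element of a one-parameter unitary group
   with strong (L^2) derivative - i H on the Schwartz core. *)
Definition generated_by (U : unitary) (H : operator R n) :=
  exists V : R -> unitary,
    [/\ V 0 =1 uid,
        forall s t, V (s + t) =1 ucomp (V s) (V t),
        forall f : S, (fun s : R =>
          sqnorm ((s^-1)%:C *: (V s f - f) + 'i *: H f)) @ 0^' --> (0 : R)
      & V 1 =1 U].

Inductive gaussian : unitary -> Prop :=
| gaussian_gen U M v c : M^T = M ->
    generated_by U (quadratic_hamiltonian M v c) -> gaussian U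
| gaussian_comp U V : gaussian U -> gaussian V -> gaussian (ucomp U V).

Definition symplectic (A : 'M[R]_(n.+1 + n.+1)) :=
  let Omega := block_mx 0 1%:M (- 1%:M) 0 : 'M[R]_(n.+1 + n.+1) in
  A *m Omega *m A^T = Omega.

Definition gaussian_action U (A : 'M[R]_(n.+1 + n.+1))
    (d : 'cV[R]_(n.+1 + n.+1)) :=
  symplectic A /\ forall i f,
    evolve U (Gamma i) f =
      \sum_j (A i j)%:C *: Gamma j f + (d i 0)%:C *: f.

(* a_j = (q_j + i p_j) / 2, so that [a_j, a_j^*] = 1 when hbar = 2. *)
Definition annihilation (j : 'I_n.+1) : operator R n := fun f =>
  2^-1 *: (qop j f + 'i *: pop j f).
Definition creation (j : 'I_n.+1) : operator R n := fun f =>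
  2^-1 *: (qop j f - 'i *: pop j f).

Definition particle_number : operator R n := fun f =>
  \sum_j creation j (annihilation j f).

Definition passive_linear U :=
  gaussian U /\ evolve U particle_number =1 particle_number.

Definition orthogonal_mx (A : 'M[R]_n.+1) := A *m A^T = 1%:M.

Definition orthogonal_gate U :=
  passive_linear U /\ exists (A B : 'M[R]_n.+1) d,
    [/\ orthogonal_mx A, orthogonal_mx B
      & gaussian_action U (block_mx A 0 0 B) d].

Definition displacement_gate U :=
  gaussian U /\ exists d, gaussian_action U 1%:M d.

Definition displaced_orthogonal_gate U :=
  exists D O, [/\ displacement_gate D, orthogonal_gate O & U =1 ucomp D O].

(* O_j O_{j-1} ... O_k *)
Definition segment (O : nat -> unitary) (j k : nat) : unitary :=
  \big[@ucomp R n/uid]_(l <- rev (index_iota k j.+1)) O l.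

(* O_t e^{i c_t q_1^3} O_{t-1} ... O_1 e^{i c_1 q_1^3} O_0 *)
Fixpoint circuit (O : nat -> unitary) (c : nat -> R) (t : nat) : unitary :=
  match t with
  | 0 => O 0
  | t'.+1 => ucomp (O t'.+1) (ucomp (cubic n (c t'.+1)) (circuit O c t'))
  end.

End Gaussian.

(* Main.v *)
(** In the Heisenberg picture the first cubic gate met by an affine combination
    [r] of quadratures adds a multiple of [q_1^2] that is linear in the gate
    parameter.  Displaced orthogonal gates map positions to positions, so this
    increment stays a polynomial in positions and commutes with all the
    remaining cubic gates: the [t] increments do not interact, and each is
    the one produced by a circuit with a single cubic gate.  The weights
    [gamma k / g] sum to 1, which reproduces the affine part. *)
Require Import Defs.
From HB Require Import structures.
From mathcomp Require Import all_boot all_order all_algebra complex.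
From mathcomp Require Import all_classical all_reals all_analysis.
Set Implicit Arguments.
Unset Strict Implicit.
Unset Printing Implicit Defensive.
Import Order.TTheory GRing.Theory Num.Theory numFieldNormedType.Exports.
Local Open Scope ring_scope.
Local Open Scope complex_scope.

(** * Heisenberg evolution as an algebra morphism *)

Section Evolution.
Variables (R : realType) (n : nat).
Local Notation S := (schwartz R n).
Local Notation operator := (operator R n).
Implicit Types (U V : unitary R n) (r s : operator) (f : S) (c : R).

Lemma udag_linear U : linear (udag U).
Proof.
move=> a f g; apply: (can_inj (uopK U)).
by rewrite (uop_linear U) !udagK.
Qed.

Lemma udagD U f g : udag U (f + g) = udag U f + udag U g.
Proof. by have := udag_linear U 1 f g; rewrite !scale1r. Qed.

Lemma udag0 U : udag U 0 = 0.
Proof. by apply: (addrI (udag U 0)); rewrite -udagD !addr0. Qed.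

Lemma udagZ U (a : R[i]) f : udag U (a *: f) = a *: udag U f.
Proof. by have := udag_linear U a f 0; rewrite !addr0 udag0 addr0. Qed.

Lemma udag_sum U (I : finType) (F : I -> S) :
  udag U (\sum_j F j) = \sum_j udag U (F j).
Proof. exact: (big_morph _ (udagD U) (udag0 U)). Qed.

Lemma evolveD U r s : evolve U (fun f => r f + s f) =
  (fun f => evolve U r f + evolve U s f).
Proof. by apply/funext => f; rewrite /evolve udagD. Qed.

Lemma evolveZ U (a : R[i]) r :
  evolve U (fun f => a *: r f) = (fun f => a *: evolve U r f).
Proof. by apply/funext => f; rewrite /evolve udagZ. Qed.

(** Inserting [U (udag U _)] between the factors makes evolution multiplicative; this later turns
    the evolution of $q_1^2$ into the square of the evolution of $q_1$. *)
Lemma evolve_comp U r s : evolve U (r \o s) = evolve U r \o evolve U s.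
Proof. by apply/funext => f; rewrite /evolve /= udagK. Qed.

(** A two-sided inverse is unique, so pointwise equal unitaries also have equal adjoints. *)
Lemma evolve_ext U V r : U =1 V -> evolve U r = evolve V r.
Proof.
move=> UV; apply/funext => f; rewrite /evolve UV.
by apply: (can_inj (uopK V)); rewrite -UV !udagK.
Qed.

(** * Affine combinations of a family of operators *)

Section Affine.
Variables (I : finType) (T : I -> operator).

(** The family [T] stays abstract to serve twice: [Gamma] for all quadratures, [qop] for positions
    alone. *)
Definition affine (w : I -> R) (d : R) : operator :=
  fun f => \sum_j (w j)%:C *: T j f + d%:C *: f.

Definition is_affine r := exists w d, r = affine w d.

Definition affine_stable U := forall r, is_affine r -> is_affine (evolve U r).

Lemma evolve_affine U w d f : evolve U (affine w d) f =
  \sum_j (w j)%:C *: evolve U (T j) f + d%:C *: f.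
Proof.
rewrite /evolve /affine udagD udagZ uopK udag_sum.
by congr (_ + _); apply: eq_bigr => j _; rewrite udagZ.
Qed.

Lemma is_affine_gen j : is_affine (T j).
Proof.
exists (fun k => (k == j)%:R), 0; apply/funext => f.
rewrite /affine scale0r addr0 (bigD1 j) //= eqxx scale1r big1 ?addr0 //.
by move=> k /negbTE ->; rewrite scale0r.
Qed.

Lemma affine_stable_gen U :
  (forall j, is_affine (evolve U (T j))) -> affine_stable U.
Proof.
move=> /choice[A /choice[b AP]] _ [w [d ->]].
(* Affine maps compose: the row [w] is multiplied by the matrix [A], and the offsets [b], weighted
   by [w], are added to [d]. *)
exists (fun k => \sum_j w j * A j k), (\sum_j w j * b j + d).
apply/funext => f; rewrite evolve_affine /affine.
rewrite rmorphD scalerDl addrA; congr (_ + _).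
under eq_bigr => j _ do
  rewrite AP /affine scalerDr scaler_sumr scalerA -rmorphM.
rewrite big_split /= rmorph_sum scaler_suml; congr (_ + _).
rewrite exchange_big; apply: eq_bigr => k _ /=.
rewrite rmorph_sum scaler_suml; apply: eq_bigr => j _.
by rewrite scalerA -rmorphM.
Qed.

Lemma affine_stable_uid : affine_stable uid.
Proof. by []. Qed.

Lemma affine_stable_comp U V :
  affine_stable U -> affine_stable V -> affine_stable (ucomp U V).
Proof. by move=> sU sV r /sU /sV. Qed.

Lemma affine_stable_ext U V : U =1 V -> affine_stable V -> affine_stable U.
Proof. by move=> UV sV r /sV; rewrite -(evolve_ext r UV). Qed.

End Affine.

(** * Gaussian gates acting on quadratures and on positions *)

Lemma Gamma_lshift (j : 'I_n.+1) : Gamma (lshift n.+1 j) = qop j :> operator.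
Proof. by rewrite /Gamma -[lshift _ j]/(unsplit (inl j)) unsplitK. Qed.

Lemma Gamma_rshift (j : 'I_n.+1) : Gamma (rshift n.+1 j) = pop j :> operator.
Proof. by rewrite /Gamma -[rshift _ j]/(unsplit (inr j)) unsplitK. Qed.

Lemma affine_stable_gaussian_action U A d :
  gaussian_action U A d -> affine_stable Gamma U.
Proof.
move=> [_ UA]; apply: affine_stable_gen => i.
by exists (A i), (d i 0); apply/funext.
Qed.

(** The zero upper-right block removes every momentum from the evolution of a position. *)
Lemma affine_stable_position U A B C d :
  gaussian_action U (block_mx A 0 B C) d -> affine_stable qop U.
Proof.
move=> [_ UA]; apply: affine_stable_gen => j.
exists (A j), (d (lshift n.+1 j) 0); apply/funext => f.
rewrite -Gamma_lshift UA big_split_ord /= [X in _ + X + _]big1 => [|k _].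
  rewrite addr0; congr (_ + _); apply: eq_bigr => k _.
  by rewrite block_mxEul Gamma_lshift.
by rewrite block_mxEur mxE scale0r.
Qed.

Lemma affine_stable_displaced U : displaced_orthogonal_gate U ->
  affine_stable Gamma U /\ affine_stable qop U.
Proof.
move=> [D [V [[_ [d dD]] [_ [A [B [e [_ _ aV]]]]] UE]]].
(* The identity matrix of a displacement, written in blocks, has the zero corner required for
   positions. *)
have dD' := dD; rewrite scalar_mx_block in dD'.
split; apply: affine_stable_ext UE _; apply: affine_stable_comp.
- exact: affine_stable_gaussian_action dD.
- exact: affine_stable_gaussian_action aV.
- exact: affine_stable_position dD'.
- exact: affine_stable_position aV.
Qed.

(** * Action of the cubic phase gate *)

Lemma cubic_phaseNK c (x : 'rV[R]_n.+1) :
  cubic_phase (- c) x * cubic_phase c x = 1.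
Proof. by rewrite /cubic_phase -expiD mulNr addNr expi0. Qed.

Lemma cubic_evolve_q c (j : 'I_n.+1) : evolve (cubic n c) (qop j) = qop j.
Proof.
apply/funext => f; apply: val_inj; apply/funext => x /=.
by rewrite mulrCA [X in _ * X]mulrA cubic_phaseNK mul1r.
Qed.

Lemma cubic_evolve_position c r : is_affine qop r -> evolve (cubic n c) r = r.
Proof.
move=> [w [d ->]]; apply/funext => f; rewrite evolve_affine.
by under eq_bigr => j _ do rewrite cubic_evolve_q.
Qed.

(** The phase depends on the first coordinate only, so its derivative in any other direction
    vanishes and those momenta are fixed. *)
Lemma cubic_evolve_pj c (j : 'I_n.+1) f : evolve (cubic n c) (pop j) f =
  pop j f + (c * (6 * (ord0 == j)%:R))%:C *: qop ord0 (qop ord0 f).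
Proof.
have [<- | j0] := eqVneq ord0 j.
  by rewrite cubic_evolve_p mulr1 [6 * c]mulrC.
rewrite !mulr0 scale0r addr0.
apply: val_inj; apply/funext => x; rewrite /= !fctE /=.
have := is_cderiveM (is_cderive_cubic c x j)
  (cderivableP (schwartz_derivable (schwartzP f) j x)).
move/partialE; rewrite /GRing.scale /= => ->.
rewrite (negbTE j0) !mulr0 !(mul0r, mulr0) add0r.
by rewrite mulrCA [X in _ * X]mulrA cubic_phaseNK mul1r.
Qed.

Lemma cubic_evolve_affine c w d f : evolve (cubic n c) (affine Gamma w d) f =
  affine Gamma w d f +
    (c * (6 * w (rshift n.+1 ord0)))%:C *: qop ord0 (qop ord0 f).
Proof.
rewrite evolve_affine /affine addrAC; congr (_ + _).
rewrite !big_split_ord -addrA; congr (_ + _).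
  by apply: eq_bigr => j _; rewrite Gamma_lshift cubic_evolve_q.
under eq_bigr => j _ do
  rewrite Gamma_rshift cubic_evolve_pj scalerDr scalerA -rmorphM.
rewrite big_split /=; congr (_ + _).
  by apply: eq_bigr => j _; rewrite Gamma_rshift.
rewrite (bigD1 ord0) // big1 => [|j /= /negbTE j0].
  rewrite /= addr0 mulr1; congr (_%:C *: _).
  by rewrite [RHS]mulrA [RHS]mulrC.
by rewrite eq_sym j0 !mulr0 scale0r.
Qed.

(** The parameter is set to 1 so that, on affine [r], a gate of parameter [c] contributes [c] times
    this fixed operator. *)
Definition cubic_increment r : operator :=
  fun f => evolve (cubic n 1) r f - r f.

Lemma cubic_increment_affine r : is_affine Gamma r -> exists b : R,
  cubic_increment r = (fun f => b%:C *: (qop ord0 \o qop ord0) f).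
Proof.
move=> [w [d ->]]; exists (6 * w (rshift n.+1 ord0)); apply/funext => f.
by rewrite /cubic_increment cubic_evolve_affine addrC addKr mul1r.
Qed.

Lemma cubic_evolveE c r : is_affine Gamma r ->
  evolve (cubic n c) r = (fun f => r f + c%:C *: cubic_increment r f).
Proof.
move=> [w [d ->]]; apply/funext => f.
rewrite /cubic_increment !cubic_evolve_affine [X in _ = _ + _ *: (X - _)]addrC.
by rewrite addrK mul1r scalerA -rmorphM.
Qed.

End Evolution.

(** * Segments and circuits with several cubic gates *)

Section Circuit.
Variables (R : realType) (n : nat) (O : nat -> unitary R n) (gamma : nat -> R).
Implicit Types (r : operator R n) (t k : nat).

(** The bound admits [k = t.+1], where the remaining segment is the empty product. *)
Lemma evolve_segmentS t k r : (k <= t.+1)%N ->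
  evolve (segment O t.+1 k) r = evolve (segment O t k) (evolve (O t.+1) r).
Proof.
move=> kt; rewrite /segment.
have -> : index_iota k t.+2 = rcons (index_iota k t.+1) t.+1.
  by rewrite /index_iota subSn // -addn1 iotaD subnKC //= cats1.
by rewrite rev_rcons big_cons.
Qed.

Lemma evolve_segment_empty t r : evolve (segment O t t.+1) r = r.
Proof. by rewrite /segment /index_iota subnn big_nil. Qed.

Lemma evolve_segment00 r : evolve (segment O 0 0) r = evolve (O 0) r.
Proof. by rewrite /segment /index_iota /= big_cons big_nil. Qed.

Lemma evolve_segment_cat t k r : (k <= t)%N ->
  evolve (segment O k 0) (evolve (segment O t k.+1) r) =
  evolve (segment O t 0) r.
Proof.
elim: t r => [|t IHt] r.
  by rewrite leqn0 => /eqP ->; rewrite evolve_segment_empty.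
rewrite leq_eqVlt => /predU1P[->|kt]; first by rewrite evolve_segment_empty.
by rewrite !evolve_segmentS // IHt.
Qed.

Lemma affine_stable_segment (I : finType) (T : I -> operator R n) t k :
  (forall l, (l <= t)%N -> affine_stable T (O l)) ->
  affine_stable T (segment O t k).
Proof.
move=> sO; rewrite /segment big_seq; apply: big_ind.
- exact: affine_stable_uid.
- exact: affine_stable_comp.
- by move=> l; rewrite mem_rev mem_index_iota ltnS => /andP[_ /sO].
Qed.

Lemma evolve_circuit_position t r :
  (forall l, (l <= t)%N -> affine_stable qop (O l)) -> is_affine qop r ->
  evolve (circuit O gamma t) r = evolve (segment O t 0) r.
Proof.
elim: t r => [|t IHt] r sO ar; first by rewrite evolve_segment00.
have ar1 := sO _ (leqnn _) _ ar.
rewrite evolve_segmentS // -IHt //; last by move=> l /leqW; apply: sO.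
(* Adjoints reverse products: the leftmost gate [O t.+1] meets [r] first, then its cubic gate, then
   the shorter circuit. *)
rewrite -[LHS]/(evolve (circuit O gamma t)
  (evolve (cubic n (gamma t.+1)) (evolve (O t.+1) r))).
by rewrite cubic_evolve_position.
Qed.

Lemma evolve_circuit_increment t r :
  (forall l, (l <= t)%N -> affine_stable qop (O l)) -> is_affine Gamma r ->
  evolve (circuit O gamma t) (cubic_increment r) =
  evolve (segment O t 0) (cubic_increment r).
Proof.
move=> sO /cubic_increment_affine[b ->].
rewrite !evolveZ !evolve_comp evolve_circuit_position //.
exact: is_affine_gen.
Qed.

(** Induction on [t] peels off the leftmost gates. Their increment passes through the shorter
    circuit as through bare gates; the affine part goes to the induction hypothesis. *)
Lemma evolve_circuit t r f :
  (forall l, (l <= t)%N -> affine_stable Gamma (O l)) ->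
  (forall l, (l <= t)%N -> affine_stable qop (O l)) ->
  is_affine Gamma r ->
  evolve (circuit O gamma t) r f = evolve (segment O t 0) r f +
    \sum_(1 <= k < t.+1) (gamma k)%:C *:
      evolve (segment O k.-1 0)
        (cubic_increment (evolve (segment O t k) r)) f.
Proof.
elim: t r => [|t IHt] r sG sq ar.
  by rewrite big_geq // addr0 evolve_segment00.
have sG' l : (l <= t)%N -> affine_stable Gamma (O l) by move=> /leqW /sG.
have sq' l : (l <= t)%N -> affine_stable qop (O l) by move=> /leqW /sq.
have ar1 := sG _ (leqnn _) _ ar.
rewrite -[LHS]/(evolve (circuit O gamma t)
  (evolve (cubic n (gamma t.+1)) (evolve (O t.+1) r)) f).
rewrite cubic_evolveE // evolveD evolveZ evolve_circuit_increment // IHt //.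
have sumS (F : nat -> schwartz R n) :
  \sum_(1 <= k < t.+2) F k = \sum_(1 <= k < t.+1) F k + F t.+1.
  exact: big_nat_recr.
(* The new summand [k = t.+1] is the increment just split off; the segment above it reduces to
   [O t.+1]. *)
rewrite sumS !evolve_segmentS // evolve_segment_empty addrA.
congr (_ + _ + _); rewrite !big_nat; apply: eq_bigr => k /andP[_ kt].
by rewrite evolve_segmentS // ltnW.
Qed.

End Circuit.

(** Halving all [gamma k] passes to the normalization $p_1 + 3c\,q_1^2$ of the cubic gate and leaves
    the weights [gamma k / g] unchanged. *)
Theorem theorem4 (R : realType) (n t : nat) (Og : nat -> unitary R n)
    (gamma : nat -> R) (i : 'I_(n.+1 + n.+1)) :
  let g := \sum_(1 <= k < t.+1) gamma k in
  (forall k, (k <= t)%N -> displaced_orthogonal_gate (Og k)) ->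
  g != 0 ->
  forall f : schwartz R n,
    evolve (circuit Og gamma t) (Gamma i) f =
    \sum_(1 <= k < t.+1) (gamma k / g)%:C *:
      evolve (ucomp (segment Og t k)
               (ucomp (cubic n g) (segment Og k.-1 0))) (Gamma i) f.
Proof.
move=> g dO g0 f.
have sG l : (l <= t)%N -> affine_stable Gamma (Og l).
  by move=> /dO /affine_stable_displaced[].
have sq l : (l <= t)%N -> affine_stable qop (Og l).
  by move=> /dO /affine_stable_displaced[].
have ai : is_affine Gamma (Gamma i : operator R n) by apply: is_affine_gen.
rewrite evolve_circuit //.
have -> : evolve (segment Og t 0) (Gamma i) f =
    \sum_(1 <= k < t.+1) (gamma k / g)%:C *:
      evolve (segment Og t 0) (Gamma i) f.
  by rewrite -scaler_suml -rmorph_sum -mulr_suml divff // scale1r.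
(* Summands are compared one by one; the index is shifted so that [k.-1] becomes [k]. *)
rewrite -big_split !big_nat; apply: eq_bigr => -[//|k] /andP[_ kt].
rewrite -[evolve (ucomp _ _) _]/(evolve (segment Og k 0)
  (evolve (cubic n g) (evolve (segment Og t k.+1) (Gamma i)))).
rewrite cubic_evolveE; last exact: affine_stable_segment ai.
rewrite evolveD evolveZ evolve_segment_cat; last exact: ltnW.
(* The weight [gamma k / g] times the gate parameter [g] gives back [gamma k]. *)
by rewrite [RHS]scalerDr scalerA -rmorphM divfK.
Qed.
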